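(* Let $X$ be a topological space. Let $M\subset\mathcal{M}_s(X)$ and $N\subset\mathcal{M}(X)$ be compact convex sets such that $\mu\perp\nu$ whenever $\mu\in M$ and $\nu\in N$, and suppose that there is a countable set $H\subset \mathcal{C}(X,[-1,1])$ such that $|\mu|(X)=\sup\{\mu(h): h\in H\}$ for every $\mu\in M$. Then there is a $Z_\sigma$ set $B\subset X$ such that every $\mu\in M$ sits on $X\setminus B$ and every $\nu\in N$ sits on $B$.
   Context: $X$ is an arbitrary topological space. $\mathcal{C}(X,Y)$ is the set of continuous functions $X\to Y$; $\mathcal{C}(X)=\mathcal{C}(X,\mathbb{R})$; $\mathcal{C}_b(X)$ is the set of bounded functions in $\mathcal{C}(X)$. The Baire sets of $X$ are the members of the smallest $\sigma$-algebra with respect to which all functions in $\mathcal{C}(X)$ are measurable. A zero-set is a set $f^{-1}(0)$ with $f\in\mathcal{C}(X)$; a $Z_\sigma$ set is a countable union of zero-sets. $\mathcal{M}_s(X)$ is the set of signed (real-valued, countably additive) measures on the Baire sets of $X$, and $\mathcal{M}(X)\subset\mathcal{M}_s(X)$ is the subset of non-negative measures. For $\mu\in\mathcal{M}_s(X)$, $\mu(h):=\int_X h\,d\mu$, and $|\mu|=\mu^++\mu^-$ is the total variation, where $\mu=\mu^+-\mu^-$ is the Jordan decomposition. $\mathcal{M}_s(X)$ and its subsets are always equipped with the weak$^*$-topology, i.e. the coarsest topology making all maps $\mu\mapsto\mu(f)$, $f\in\mathcal{C}_b(X)$, continuous; compactness refers to it. A measure $\mu\in\mathcal{M}_s(X)$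 sits on a Baire set $B$ if $\mu(E)=0$ for every Baire set $E\subset X\setminus B$. Measures $\mu,\nu$ are mutually singular, $\mu\perp\nu$, if they sit on disjoint Baire sets. *)

(* Defs.v *)
From HB Require Import structures.
From mathcomp Require Import all_boot all_order all_algebra.
From mathcomp Require Import all_classical all_reals all_analysis.

Set Implicit Arguments.
Unset Strict Implicit.
Unset Printing Implicit Defensive.
Import Order.TTheory GRing.Theory Num.Theory.
Import numFieldNormedType.Exports.
Local Open Scope classical_set_scope.
Local Open Scope ring_scope.

(* [X] is a pointed topological space only because the measurable types of the
   library carry a base point; the point plays no role beyond inhabitation. *)

Definition baire_generators (R : realType) (X : ptopologicalType) :
    set (set X) :=
  \bigcup_(f in [set f : X -> R | continuous f])
    preimage_set_system [set: X] f measurable.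

Definition baireType (R : realType) (X : ptopologicalType) :=
  g_sigma_algebraType (@baire_generators R X).

HB.instance Definition _ (R : realType) (X : ptopologicalType) :=
  Measurable.on (baireType R X).

Definition zero_set (R : realType) (X : ptopologicalType) (Z : set X) : Prop :=
  exists2 f : X -> R, continuous f & Z = f @^-1` [set 0].

Definition Zsigma (R : realType) (X : ptopologicalType) (B : set X) : Prop :=
  exists2 F : nat -> set X, (forall n, zero_set R (F n)) & B = \bigcup_n F n.

(* Charges of the library are functions on all subsets whose values are
   constrained (finite, sigma-additive) on the measurable sets only, so a signed
   measure on the Baire sets has many representatives here.  All the notions
   below depend only on the values on Baire sets. *)
Definition smeasure (R : realType) (X : ptopologicalType) : Type :=
  {charge set (baireType R X) -> \bar R}.

HB.instance Definition _ (R : realType) (X : ptopologicalType) :=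
  gen_eqMixin (smeasure R X).
HB.instance Definition _ (R : realType) (X : ptopologicalType) :=
  gen_choiceMixin (smeasure R X).

Section charge_integral.
Context d (T : measurableType d) (R : realType).
Variable mu : {charge set T -> \bar R}.

Lemma ex_hahn_decomposition :
  exists PN : set T * set T, hahn_decomposition mu PN.1 PN.2.
Proof. by have [P [N PN]] := Hahn_decomposition mu; exists (P, N). Qed.

(* The Jordan decomposition below does not depend on the Hahn decomposition that
   is chosen: see [Hahn_decomposition_uniq]. *)
Definition hahn : set T * set T := projT1 (cid ex_hahn_decomposition).

Lemma hahnP : hahn_decomposition mu hahn.1 hahn.2.
Proof. exact: projT2 (cid ex_hahn_decomposition). Qed.

Definition charge_integral (f : T -> R) : R :=
  Rintegral (jordan_pos hahnP) [set: T] f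
  - Rintegral (jordan_neg hahnP) [set: T] f.

Definition charge_total_variation : set T -> \bar R := charge_variation hahnP.

Definition sits_on (B : set T) : Prop :=
  measurable B /\ forall E, measurable E -> E `<=` ~` B -> mu E = 0%E.

End charge_integral.

Definition mutually_singular d (T : measurableType d) (R : realType)
    (mu nu : {charge set T -> \bar R}) : Prop :=
  exists A B : set T, [/\ A `&` B = set0, sits_on mu A & sits_on nu B].

Definition nonneg_smeasure (R : realType) (X : ptopologicalType) :
    set (smeasure R X) :=
  [set mu | forall A : set (baireType R X), measurable A -> (0 <= mu A)%E].

(* The convex combination is only required up to equality on Baire sets. *)
Definition convex_smeasures (R : realType) (X : ptopologicalType)
    (M : set (smeasure R X)) : Prop :=
  forall (mu nu : smeasure R X) (t : R), M mu -> M nu -> 0 <= t <= 1 ->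
  exists2 rho : smeasure R X, M rho &
    forall A : set (baireType R X), measurable A ->
      rho A = (t%:E * mu A + (1 - t)%:E * nu A)%E.

Definition Cb (R : realType) (X : ptopologicalType) : set (X -> R) :=
  [set f | continuous f /\ bounded_fun f].

Definition weak_star (R : realType) (X : ptopologicalType) : Type :=
  sup_topology (fun f : {f : X -> R | Cb f} =>
    Topological.class (initial_topology
      (fun mu : smeasure R X => charge_integral mu (sval f) : R))).

HB.instance Definition _ (R : realType) (X : ptopologicalType) :=
  Topological.on (weak_star R X).

Definition weak_star_compact (R : realType) (X : ptopologicalType)
    (M : set (smeasure R X)) : Prop :=
  compact (M : set (weak_star R X)).

(* Main.v *)
(* Write |mu|(f) for the integral of f against the total variation of mu.

   If mu and nu are singular and nu >= 0, regularity of Baire measures gives a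
   continuous f with values in [0, 1], |mu|(f) and nu(1 - f) small.  A minimax
   argument makes f uniform: mu(h f) and nu(1 - f) are affine and weak* continuous
   in mu and nu and affine in f, and mu(h f) <= |mu|(f) for |h| <= 1.  Since
   |mu|(f) itself is neither affine nor continuous in mu, it is replaced by the
   countably many mu(h f), h in H.  Enumerating H as h_0, h_1, ... this yields f_n
   with mu(h_j f_n) < 2^-(n+1) for j < n and all mu in M, and
   nu(1 - f_n) < 2^-(n+1) for all nu in N.

   As |mu|(f) - mu(h f) <= |mu|(X) - mu(h), the norming property of H gives
   |mu|(f_n) -> 0 for every mu in M.  Let B be the set where f_n >= 1/2 for all
   large n.  It is a Z_sigma set, |mu|(B) = 0 by Markov's inequality, and the
   complement of B is nu-null by Borel-Cantelli. *)
From HB Require Import structures.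
Require Import Defs.
From mathcomp Require Import all_boot all_order all_algebra.
From mathcomp Require Import all_classical all_reals all_analysis.
From mathcomp Require Import measurable_realfun finmap ring lra.
Set Implicit Arguments.
Unset Strict Implicit.
Unset Printing Implicit Defensive.
Import Order.TTheory GRing.Theory Num.Theory.
Import numFieldNormedType.Exports.
Local Open Scope classical_set_scope.
Local Open Scope ring_scope.

(** * A minimax theorem for affine functions on a compact convex set *)

Section minimax.
Context {R : realType}.

(** The quotient [a / - b] is continuous with positive denominator on the compact set where
    [a >= 0], so it attains its maximum there. The conclusion is cleared of denominators to suit the
    polynomial arithmetic of [minimax_two]. *)
Lemma compact_ratio_max (T : topologicalType) (K : set T) (a b : T -> R) :
  compact K -> continuous a -> continuous b ->
  (forall x, K x -> 0 <= a x -> b x < 0) ->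
  (forall x, K x -> a x < 0) \/
  exists x0, [/\ K x0, 0 <= a x0 &
    forall x, K x -> 0 <= a x -> a x * - b x0 <= a x0 * - b x].
Proof.
move=> cK ca cb ab.
have [Ka0|/set0P Ka0] := eqVneq (K `&` [set x | 0 <= a x]) set0.
  left => x Kx; rewrite ltNge; apply/negP => ax.
  by have : (K `&` [set x | 0 <= a x]) x by []; rewrite Ka0.
right.
have cKa : compact (K `&` [set x | 0 <= a x]).
  apply: compact_closedI => //.
  by apply: (@preimage_closed _ _ a [set y | 0 <= y]);
    [move=> x _; exact: ca|exact: closed_ge].
have cr : {within K `&` [set x | 0 <= a x], continuous (fun x => a x / - b x)}.
  rewrite continuous_subspace_in => t /set_mem [Kt at0].
  have bt : - b t != 0 by rewrite oppr_eq0 lt_eqF// ab.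
  have : {for t, continuous (fun x => a x / - b x)}.
    by apply: cvgM; [exact: ca|apply: cvgV => //; apply: cvgN; exact: cb].
  exact: continuous_subspaceT_for.
have [x0 /set_mem[Kx0 ax0] x0max] := compact_EVT_max Ka0 cKa cr.
exists x0; split => // x Kx ax.
have := x0max x (mem_set (conj Kx ax)).
have bx := ab _ Kx ax; have bx0 := ab _ Kx0 ax0.
by rewrite ler_pdivrMr ?oppr_gt0// mulrAC ler_pdivlMr ?oppr_gt0.
Qed.

(** A good [t] must satisfy [a / - b < (1 - t) / t] where [a >= 0] and [b / - a < t / (1 - t)] where
    [b >= 0]. Such a [t] exists because the two maximal ratios, attained at [x0] and [y0], have
    product less than 1; this is [key], obtained from convexity along the segment from [x0] to
    [y0]. *)
Lemma minimax_two (T : topologicalType) (K : set T) (a b : T -> R) :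
  compact K -> continuous a -> continuous b ->
  (forall x y t, K x -> K y -> 0 <= t <= 1 -> exists2 z, K z &
    a z = t * a x + (1 - t) * a y /\ b z = t * b x + (1 - t) * b y) ->
  (forall x, K x -> a x < 0 \/ b x < 0) ->
  exists2 t, 0 <= t <= 1 & forall x, K x -> t * a x + (1 - t) * b x < 0.
Proof.
move=> cK ca cb Kconv ab.
have abl x : K x -> 0 <= a x -> b x < 0 by move=> /ab[|//]; rewrite ltNge => /negP.
have abr x : K x -> 0 <= b x -> a x < 0 by move=> /ab[//|]; rewrite ltNge => /negP.
have [a_lt0|[x0 [Kx0 a0 x0max]]] := compact_ratio_max cK ca cb abl.
  by exists 1; rewrite ?ler01 ?lexx// => x /a_lt0; rewrite subrr mul0r addr0 mul1r.
have [b_lt0|[y0 [Ky0 b1 y0max]]] := compact_ratio_max cK cb ca abr.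
  by exists 0; rewrite ?ler01 ?lexx// => x /b_lt0; rewrite subr0 mul0r add0r mul1r.
have b0 := abl _ Kx0 a0; have a1 := abr _ Ky0 b1.
(* the point of the segment [x0, y0] where [a] vanishes *)
have key : a x0 * b y0 < a y0 * b x0.
  have d0 : 0 < a x0 - a y0 by lra.
  have [|z Kz [az bz]] := Kconv _ _ (- a y0 / (a x0 - a y0)) Kx0 Ky0.
    by rewrite ler_pdivrMr// mul1r divr_ge0 /=; lra.
  have e : 1 - - a y0 / (a x0 - a y0) = a x0 / (a x0 - a y0).
    by field; rewrite gt_eqF.
  rewrite e in az bz.
  have {}az : 0 <= a z.
    by rewrite az le_eqVlt (_ : _ + _ = 0) ?eqxx//; field; rewrite gt_eqF.
  have := abl _ Kz az; rewrite bz.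
  rewrite mulrAC (mulrAC (a x0)) -mulrDl pmulr_llt0 ?invr_gt0//.
  lra.
(* With these weights [p * a + q * b] takes the same value [a x0 * b y0 - a y0 * b x0] at [x0] and
   [y0], negative by [key]. Maximality of the two ratios carries the sign over to the points where
   [a >= 0] or [b >= 0]; elsewhere both terms are negative. *)
pose p := b y0 - b x0; pose q := a x0 - a y0.
have p0 : 0 < p by rewrite /p; lra.
have q0 : 0 < q by rewrite /q; lra.
have pq0 : 0 < p + q by rewrite addr_gt0.
exists (p / (p + q)).
  by rewrite ler_pdivrMr// mul1r divr_ge0//=; lra.
have -> : 1 - p / (p + q) = q / (p + q) by field; rewrite gt_eqF.
move=> x Kx; rewrite mulrAC (mulrAC q) -mulrDl pmulr_llt0 ?invr_gt0//.
have [ax|ax] := leP 0 (a x).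
  have bx := abl _ Kx ax; have := x0max _ Kx ax.
  rewrite /p /q; nra.
have [bx|bx] := leP 0 (b x); last by rewrite ltr_wnDr ?pmulr_rlt0// ltW// pmulr_rlt0.
have := y0max _ Kx bx; rewrite /p /q; nra.
Qed.

(** By compactness finitely many members of [G] suffice pointwise. Induction on their list removes
    the head [f]: the part of [K] where [e <= phi x f] is again compact and convex and is handled by
    the tail, which yields one [g]; [minimax_two] then merges [f] and [g] into a single member of
    [G]. *)
Lemma minimax (T : topologicalType) (I : choiceType) (K : set T) (G : set I)
    (phi : T -> I -> R) (e : R) :
  compact K -> (forall f, G f -> continuous (phi ^~ f)) ->
  (forall x y t, K x -> K y -> 0 <= t <= 1 -> exists2 z, K z &
    forall f, G f -> phi z f = t * phi x f + (1 - t) * phi y f) ->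
  (forall f g t, G f -> G g -> 0 <= t <= 1 -> exists2 k, G k &
    forall x, K x -> phi x k = t * phi x f + (1 - t) * phi x g) ->
  G !=set0 ->
  (forall x, K x -> exists2 f, G f & phi x f < e) ->
  exists2 f, G f & forall x, K x -> phi x f < e.
Proof.
move=> cK cphi Kconv Gconv [f0 Gf0] Kphi.
have ophi f : G f -> open [set x | phi x f < e].
  move=> /cphi cf; apply: (@open_comp _ _ (phi ^~ f) [set y | y < e]).
    by move=> x _; exact: cf.
  exact: open_lt.
have [l lG lK] : exists2 l : seq I, (forall f, f \in l -> G f) &
    forall x, K x -> exists2 f, f \in l & phi x f < e.
  have [K0|/set0P[x0 Kx0]] := eqVneq K set0.
    by exists [::] => // x; rewrite K0.
  (* The finite subcover is extracted in the space pointed by [x0]; an empty [K] offers no such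
     point and was settled by the empty list. *)
  pose T' : ptopologicalType := HB.pack (Topological.sort T) (isPointed.Build T x0).
  have : cover_compact (K : set T') by rewrite -compact_cover.
  move=> /(_ _ G (fun f => [set x | phi x f < e]) ophi)[|D DG DK].
    by move=> x /Kphi[f Gf fx]; exists f.
  exists (enum_fset D) => [f fD|x /DK [f fD fx]].
    by have := DG f fD => /set_mem.
  by exists f.
elim: l K cK Kconv {Kphi} Gconv lG lK => [|f l IH] K cK Kconv Gconv lG lK.
  by exists f0 => // x /lK[].
have Gf : G f by apply: lG; rewrite mem_head.
have cK' : compact (K `&` [set x | e <= phi x f]).
  apply: compact_closedI => //.
  by apply: (@preimage_closed _ _ (phi ^~ f) [set y | e <= y]);
    [move=> x _; exact: cphi|exact: closed_ge].
have [||||g Gg gK] := IH _ cK'.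
- move=> x y t [Kx fx] [Ky fy] t01; have [z Kz zE] := Kconv _ _ _ Kx Ky t01.
  by exists z => //; split => //=; rewrite zE//; move: fx fy t01 => /= fx fy; nra.
- move=> g h t Gg Gh t01; have [k Gk kE] := Gconv _ _ _ Gg Gh t01.
  by exists k => // x [] /kE.
- by move=> g gl; apply: lG; rewrite inE gl orbT.
- move=> x [Kx fx]; have [g] := lK x Kx.
  rewrite inE => /orP[/eqP ->|gl gx]; last by exists g.
  by rewrite ltNge fx.
have [||||t t01 tK] := @minimax_two T K (fun x => phi x f - e) (fun x => phi x g - e) cK.
- by move=> x; apply: cvgB; [exact: cphi|exact: cvg_cst].
- by move=> x; apply: cvgB; [exact: cphi|exact: cvg_cst].
- move=> x y t Kx Ky t01; have [z Kz zE] := Kconv _ _ _ Kx Ky t01.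
  by exists z => //; rewrite !zE//; split; lra.
- move=> x Kx; have [fx|fx] := ltP (phi x f) e; first by left; lra.
  by right; rewrite subr_lt0 gK.
have [k Gk kE] := Gconv _ _ _ Gf Gg t01.
by exists k => // x Kx; rewrite kE//; have := tK x Kx; lra.
Qed.

End minimax.

(** * Integration against a signed measure and against its total variation *)

Section charge_integral_theory.
Context d (T : measurableType d) (R : realType).
Implicit Types (mu nu rho : {charge set T -> \bar R}) (f g h : T -> R) (a b c t : R).

Lemma bounded_measurable_integrable (m : {measure set T -> \bar R}) f c :
  (m setT < +oo)%E -> measurable_fun setT f -> (forall x, `|f x| <= c) ->
  m.-integrable setT (EFin \o f).
Proof.
move=> moo mf fc; apply: measurable_bounded_integrable => //.
exists c; split; first exact: num_real.
by move=> e ce x _; exact: le_trans (fc x) (ltW ce).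
Qed.

Lemma jordan_pos_lty mu : (jordan_pos (hahnP mu) setT < +oo)%E.
Proof. by rewrite ltey_eq fin_num_measure. Qed.

Lemma jordan_neg_lty mu : (jordan_neg (hahnP mu) setT < +oo)%E.
Proof. by rewrite ltey_eq fin_num_measure. Qed.

Lemma charge_variation_fin mu A : measurable A ->
  charge_variation (hahnP mu) A \is a fin_num.
Proof. exact: fin_num_measure. Qed.

Lemma charge_variation_lty mu : (charge_variation (hahnP mu) setT < +oo)%E.
Proof. by rewrite ltey_eq charge_variation_fin. Qed.

Lemma jordan_decompB mu A : measurable A ->
  mu A = (jordan_pos (hahnP mu) A - jordan_neg (hahnP mu) A)%E.
Proof. by move=> mA; rewrite (jordan_decomp (hahnP mu) mA)/= /cadd/= cscaleN1. Qed.

Lemma charge_variationE mu A :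
  charge_variation (hahnP mu) A =
  (jordan_pos (hahnP mu) A + jordan_neg (hahnP mu) A)%E.
Proof. by []. Qed.

Definition variation_integral mu f : R :=
  Rintegral (charge_variation (hahnP mu)) setT f.

Lemma variation_integralE mu f c :
  measurable_fun setT f -> (forall x, `|f x| <= c) ->
  variation_integral mu f =
  Rintegral (jordan_pos (hahnP mu)) setT f +
  Rintegral (jordan_neg (hahnP mu)) setT f.
Proof.
move=> mf fc.
have ip := bounded_measurable_integrable (jordan_pos_lty mu) mf fc.
have im := bounded_measurable_integrable (jordan_neg_lty mu) mf fc.
rewrite /variation_integral /Rintegral.
rewrite -fineD ?integrable_fin_num//.
rewrite -(integral_measure_add measurableT ip im).
congr fine; apply: eq_measure_integral => A mA _.
exact/esym/measure_addE.
Qed.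

Lemma Rintegral_lin (m : {measure set T -> \bar R}) f g a b c :
  (m setT < +oo)%E -> measurable_fun setT f -> measurable_fun setT g ->
  (forall x, `|f x| <= c) -> (forall x, `|g x| <= c) ->
  Rintegral m setT (fun x => a * f x + b * g x) =
  a * Rintegral m setT f + b * Rintegral m setT g.
Proof.
move=> moo mf mg fc gc.
have If := bounded_measurable_integrable moo mf fc.
have Ig := bounded_measurable_integrable moo mg gc.
have I k (u : T -> R) : m.-integrable setT (EFin \o u) ->
    m.-integrable setT (EFin \o (fun x => k * u x)).
  move=> Iu; rewrite (_ : _ \o _ = fun x => (k%:E * (EFin \o u) x)%E)//.
  exact: integrableZl.
by rewrite RintegralD ?RintegralZl//; apply: I.
Qed.

Lemma charge_integral_lin mu f g a b c :
  measurable_fun setT f -> measurable_fun setT g ->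
  (forall x, `|f x| <= c) -> (forall x, `|g x| <= c) ->
  charge_integral mu (fun x => a * f x + b * g x) =
  a * charge_integral mu f + b * charge_integral mu g.
Proof.
move=> mf mg fc gc; rewrite /charge_integral.
rewrite (Rintegral_lin _ _ (jordan_pos_lty mu) mf mg fc gc).
rewrite (Rintegral_lin _ _ (jordan_neg_lty mu) mf mg fc gc).
by ring.
Qed.

Lemma variation_integral_lin mu f g a b c :
  measurable_fun setT f -> measurable_fun setT g ->
  (forall x, `|f x| <= c) -> (forall x, `|g x| <= c) ->
  variation_integral mu (fun x => a * f x + b * g x) =
  a * variation_integral mu f + b * variation_integral mu g.
Proof.
by move=> mf mg fc gc; apply: Rintegral_lin mf mg fc gc; exact: charge_variation_lty.
Qed.

Lemma variation_integral_le mu f g c :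
  measurable_fun setT f -> measurable_fun setT g ->
  (forall x, `|f x| <= c) -> (forall x, `|g x| <= c) ->
  (forall x, f x <= g x) -> variation_integral mu f <= variation_integral mu g.
Proof.
move=> mf mg fc gc fg; apply: le_Rintegral => //.
- exact: bounded_measurable_integrable (charge_variation_lty mu) mf fc.
- exact: bounded_measurable_integrable (charge_variation_lty mu) mg gc.
Qed.

Lemma variation_integral_ge0 mu f : (forall x, 0 <= f x) ->
  0 <= variation_integral mu f.
Proof. by move=> f0; apply: Rintegral_ge0. Qed.

Lemma variation_integral1 mu :
  variation_integral mu (fun=> 1) = fine (charge_variation (hahnP mu) setT).
Proof. by rewrite /variation_integral Rintegral_cst// mul1r. Qed.

(** Since [- f <= h * f <= f], the upper bound is integrated against the positive Jordan part and
    the lower bound against the negative one. *)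
Lemma charge_integralM_le mu h f :
  measurable_fun setT h -> measurable_fun setT f ->
  (forall x, `|h x| <= 1) -> (forall x, 0 <= f x <= 1) ->
  charge_integral mu (fun x => h x * f x) <= variation_integral mu f.
Proof.
move=> mh mf h1 f01.
have mhf : measurable_fun setT (fun x => h x * f x) by exact: measurable_funM.
have f1 x : `|f x| <= 1 by have /andP[f0 f1] := f01 x; rewrite ger0_norm.
have nf1 x : `|- f x| <= 1 by rewrite normrN.
have hf x : `|h x * f x| <= f x.
  have /andP[f0 _] := f01 x.
  by rewrite normrM (ger0_norm f0) ler_piMl.
have hf1 x : `|h x * f x| <= 1.
  by apply: le_trans (hf x) _; have /andP[] := f01 x.
rewrite (variation_integralE _ mf f1) /charge_integral lerD//.
- apply: le_Rintegral => //.
  + exact: bounded_measurable_integrable (jordan_pos_lty mu) mhf hf1.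
  + exact: bounded_measurable_integrable (jordan_pos_lty mu) mf f1.
  + by move=> x _; apply: le_trans (hf x); exact: ler_norm.
- have Im := bounded_measurable_integrable (jordan_neg_lty mu) mhf hf1.
  (* The coefficients -1 and 0 only serve to move the minus sign under the integral. *)
  rewrite lerNl; have := @Rintegral_lin _ f f (- 1) 0 1 (jordan_neg_lty mu) mf mf f1 f1.
  rewrite mul0r addr0 mulN1r => <-.
  under eq_Rintegral do rewrite mul0r addr0 mulN1r.
  apply: le_Rintegral => //.
  + apply: bounded_measurable_integrable (jordan_neg_lty mu) _ nf1.
    exact: measurable_funN.
  + by move=> x _; rewrite lerNl; apply: le_trans (hf x); rewrite -normrN ler_norm.
Qed.

(* [|mu|(f) - mu(h f)] is the integral of [f] against the positive measure
   [|mu| - h mu], whose mass is [|mu|(T) - mu(h)]. *)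
Lemma variation_integral_defect mu h f :
  measurable_fun setT h -> measurable_fun setT f ->
  (forall x, `|h x| <= 1) -> (forall x, 0 <= f x <= 1) ->
  variation_integral mu f <= charge_integral mu (fun x => h x * f x) +
    (variation_integral mu (fun=> 1) - charge_integral mu h).
Proof.
move=> mh mf h1 f01.
have f1 x : `|f x| <= 1 by have /andP[f0 f1] := f01 x; rewrite ger0_norm.
have hf1 x : `|h x * f x| <= 1 by rewrite normrM mulr_ile1.
have mhf : measurable_fun setT (fun x => h x * f x) by exact: measurable_funM.
(* This is [1 - f] in the shape of the linearity lemmas; [charge_integralM_le] for [h] and [1 - f]
   is the claim after rearrangement. *)
have g01 x : 0 <= 1 * 1 + (- 1) * f x <= 1 by have := f01 x; lra.
have c1 (x : T) : `|1 : R| <= 1 by rewrite normr1.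
have mc1 : measurable_fun setT (fun _ : T => 1 : R) by exact: measurable_cst.
have mg : measurable_fun setT (fun x => 1 * 1 + (- 1) * f x).
  by apply: measurable_funD => //; apply: measurable_funM.
have := charge_integralM_le mu mh mg h1 g01.
rewrite (variation_integral_lin mu _ _ mc1 mf c1 f1).
under [X in charge_integral mu X]eq_fun => x.
  rewrite (_ : _ * _ = 1 * h x + (- 1) * (h x * f x)); last by ring.
  over.
rewrite (charge_integral_lin mu _ _ mh mhf h1 hf1) {c1}.
lra.
Qed.

(** The Jordan parts of [rho] need not be the convex combinations of those of [mu] and [nu]. Moving
    all negative parts to the other side gives an equality [L = M] of nonnegative measures, and a
    nonnegative [f] integrates additively against each side. *)
Lemma charge_integral_convex_ge0 mu nu rho t f c :
  measurable_fun setT f -> (forall x, `|f x| <= c) -> (forall x, 0 <= f x) ->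
  0 <= t <= 1 ->
  (forall A, measurable A -> rho A = t%:E * mu A + (1 - t)%:E * nu A)%E ->
  charge_integral rho f =
    t * charge_integral mu f + (1 - t) * charge_integral nu f.
Proof.
move=> mf fc f0 /andP[t0 t1] rhoE.
have s0 : 0 <= 1 - t by rewrite subr_ge0.
pose a := NngNum t0; pose b := NngNum s0.
pose P := jordan_pos (hahnP rho); pose N := jordan_neg (hahnP rho).
pose P1 := jordan_pos (hahnP mu); pose N1 := jordan_neg (hahnP mu).
pose P2 := jordan_pos (hahnP nu); pose N2 := jordan_neg (hahnP nu).
pose L := measure_add P (measure_add (mscale a N1) (mscale b N2)).
pose M := measure_add (measure_add (mscale a P1) (mscale b P2)) N.
have I (m : {measure set T -> \bar R}) : (m setT < +oo)%E ->
    (\int[m]_x (f x)%:E)%E = (Rintegral m setT f)%:E.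
  move=> moo; rewrite fineK// integrable_fin_num//.
  exact: bounded_measurable_integrable moo mf fc.
have LM A : measurable A -> L A = M A.
  move=> mA; have := rhoE A mA.
  rewrite (jordan_decompB rho mA) (jordan_decompB mu mA) (jordan_decompB nu mA).
  rewrite -/P -/N -/P1 -/N1 -/P2 -/N2.
  have -> : L A = (P A + (t%:E * N1 A + (1 - t)%:E * N2 A))%E.
    by rewrite /L measure_addE; congr (_ + _)%E; exact: measure_addE.
  have -> : M A = (t%:E * P1 A + (1 - t)%:E * P2 A + N A)%E.
    by rewrite /M measure_addE; congr (_ + _)%E; exact: measure_addE.
  have fP : P A \is a fin_num by exact: fin_num_measure.
  have fN : N A \is a fin_num by exact: fin_num_measure.
  have fP1 : P1 A \is a fin_num by exact: fin_num_measure.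
  have fN1 : N1 A \is a fin_num by exact: fin_num_measure.
  have fP2 : P2 A \is a fin_num by exact: fin_num_measure.
  have fN2 : N2 A \is a fin_num by exact: fin_num_measure.
  rewrite -(fineK fP) -(fineK fN) -(fineK fP1) -(fineK fN1) -(fineK fP2) -(fineK fN2).
  rewrite -!(EFinM, EFinN, EFinD) => -[e]; congr EFin.
  by move: e; lra.
have mEf : measurable_fun setT (EFin \o f) by exact/measurable_EFinP.
have f0' x : setT x -> (0 <= (EFin \o f) x)%E by rewrite /= lee_fin.
have : (\int[L]_x (EFin \o f) x = \int[M]_x (EFin \o f) x)%E.
  by apply: eq_measure_integral => A mA _; exact: LM.
rewrite /L /M !ge0_integral_measure_add// !ge0_integral_mscale//=.
rewrite !I ?jordan_pos_lty ?jordan_neg_lty// -!(EFinM, EFinD) => -[e].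
rewrite /charge_integral -/P -/N -/P1 -/N1 -/P2 -/N2.
by move: e; lra.
Qed.

(** The nonnegative case applies to [f + c] and to the constant [c]; the difference is the claim for
    [f]. *)
Lemma charge_integral_convex mu nu rho t f c :
  measurable_fun setT f -> (forall x, `|f x| <= c) -> 0 <= t <= 1 ->
  (forall A, measurable A -> rho A = t%:E * mu A + (1 - t)%:E * nu A)%E ->
  charge_integral rho f =
    t * charge_integral mu f + (1 - t) * charge_integral nu f.
Proof.
move=> mf fc t01 rhoE.
have c0 (x : T) : 0 <= c by exact: le_trans (fc x).
have cc (x : T) : `|c| <= c by rewrite ger0_norm// (c0 x).
have mc : measurable_fun setT (fun _ : T => c) by exact: measurable_cst.
have lin (k : {charge set T -> \bar R}) :
    charge_integral k (fun x => 1 * f x + 1 * c) =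
    charge_integral k f + charge_integral k (fun=> c).
  by rewrite (charge_integral_lin k _ _ mf mc fc cc) !mul1r.
have e1 : charge_integral rho (fun=> c) =
    t * charge_integral mu (fun=> c) + (1 - t) * charge_integral nu (fun=> c).
  by apply: charge_integral_convex_ge0 mc cc _ t01 rhoE => x; exact: (c0 x).
have fc2 x : `|1 * f x + 1 * c| <= c + c.
  by rewrite !mul1r; apply: le_trans (ler_normD _ _) _; rewrite lerD// (cc x).
have fc0 x : 0 <= 1 * f x + 1 * c.
  by have := fc x; rewrite ler_norml {c0 cc}; lra.
have m2 : measurable_fun setT (fun x => 1 * f x + 1 * c).
  by apply: measurable_funD; apply: measurable_funM.
have := charge_integral_convex_ge0 m2 fc2 fc0 t01 rhoE.
by rewrite !lin e1 {c0 cc}; lra.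
Qed.

(** The negative part of [A] is minus the charge of a measurable subset of [A], so it is both
    nonpositive and nonnegative. *)
Lemma nonneg_jordan_neg nu A : (forall A, measurable A -> (0 <= nu A)%E) ->
  measurable A -> jordan_neg (hahnP nu) A = 0%E.
Proof.
move=> nu0 mA; apply/eqP; rewrite eq_le measure_ge0 andbT.
rewrite jordan_negE cjordan_negE /crestr0 mem_set//= /crestr leeNl oppe0.
apply: nu0; apply: measurableI => //.
by have [_ [mN _] _ _] := hahnP nu.
Qed.

Lemma nonneg_charge_integral nu f c :
  (forall A, measurable A -> (0 <= nu A)%E) ->
  measurable_fun setT f -> (forall x, `|f x| <= c) ->
  charge_integral nu f = variation_integral nu f.
Proof.
move=> nu0 mf fc; rewrite (variation_integralE _ mf fc) /charge_integral.
suff -> : Rintegral (jordan_neg (hahnP nu)) setT f = 0 by rewrite subr0 addr0.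
rewrite /Rintegral (@eq_measure_integral _ _ _ _ (@mzero _ T R)).
  by rewrite integral_measure_zero.
by move=> A mA _; exact: nonneg_jordan_neg.
Qed.

(** Up to sign, both Jordan parts of the complement of [A] are charges of measurable sets that miss
    [A]. With its converse [variation_sits_on], this turns concentration of a signed measure into a
    statement on null sets of a nonnegative one. *)
Lemma sits_on_variation mu A : sits_on mu A ->
  charge_variation (hahnP mu) (~` A) = 0%E.
Proof.
move=> [mA muA]; have [[mP _] [mN _] _ _] := hahnP mu.
have mCA : measurable (~` A) by exact: measurableC.
rewrite charge_variationE jordan_posE cjordan_posE jordan_negE cjordan_negE.
rewrite /crestr0 mem_set//= /crestr !muA ?oppe0 ?adde0//.
- exact: measurableI.
- exact: measurableI.
Qed.

Lemma variation_sits_on mu A : measurable A ->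
  charge_variation (hahnP mu) (~` A) = 0%E -> sits_on mu A.
Proof.
move=> mA muA; split => // E mE EA; apply/eqP; rewrite -abse_eq0 eq_le abse_ge0 andbT.
apply: (le_trans (abse_charge_variation (hahnP mu) mE)).
rewrite -muA; apply: le_measure => //; apply: mem_set => //.
exact: measurableC.
Qed.

End charge_integral_theory.

(** * Regularity: approximation of Baire sets by continuous functions *)

Lemma ex_small_measure d (T : measurableType d) (R : realType)
    (m : {measure set T -> \bar R}) (F : nat -> set T) (e : R) :
  (m setT < +oo)%E -> (forall n, measurable (F n)) -> nonincreasing_seq F ->
  \bigcap_n F n = set0 -> 0 < e -> exists n, (m (F n) < e%:E)%E.
Proof.
move=> moo mF ndF F0 e0.
have F0oo : (m (F 0%N) < +oo)%E.
  apply: le_lt_trans moo.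
  by apply: le_measure => //; apply: mem_set.
have := @nonincreasing_cvg_mu _ _ _ m F F0oo mF.
rewrite F0 measure0 => /(_ measurable0 ndF) /fine_cvgP[mFfin mFcvg].
have [N _ mFN] : \forall n \near \oo, (m (F n) < e%:E)%E.
  near=> n.
  have fn : m (F n) \is a fin_num by near: n.
  rewrite -(fineK fn) lte_fin.
  apply: le_lt_trans (ler_norm _) _.
  near: n; exact: (cvgr0_norm_lt (fine \o (m \o F)) mFcvg).
by exists N; apply: mFN => /=.
Unshelve. all: end_near. Qed.

Section baire_regularity.
Context {R : realType} {X : ptopologicalType}.
Implicit Types (f g : X -> R) (A B : set (baireType R X)).

Definition unit_continuous : set (X -> R) :=
  [set f : X -> R | continuous f /\ forall x, 0 <= f x <= 1].

Lemma continuous_baire f : continuous f ->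
  measurable_fun [set: baireType R X] (f : baireType R X -> R).
Proof.
move=> cf _ S mS; apply: sub_sigma_algebra; exists f => //.
by exists S.
Qed.

Variable m : {measure set (baireType R X) -> \bar R}.
Hypothesis moo : (m setT < +oo)%E.

(** Regularity is phrased as approximation in the L1 norm, a condition visibly stable under
    complements and countable unions. *)
Definition approximable : set (set (baireType R X)) :=
  [set B | measurable B /\ forall e : R, 0 < e -> exists2 f,
    unit_continuous f & (\int[m]_x (`|f x - \1_B x|)%:E < e%:E)%E].

Lemma measurable_dist_indic f B : continuous f -> measurable B ->
  measurable_fun setT (fun x : baireType R X => (`|f x - \1_B x|)%:E).
Proof.
move=> /continuous_baire mf mB; apply/measurable_EFinP.
apply: measurableT_comp => //; apply: measurable_funB => //.
Qed.

Lemma approximable_set0 : approximable set0.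
Proof.
split=> // e e0; exists (fun=> 0).
  by split=> [x|x]; [exact: cvg_cst|rewrite lexx ler01].
under eq_integral do rewrite indic0 subr0 normr0.
by rewrite integral0 lte_fin.
Qed.

Lemma approximable_setC B : approximable B -> approximable (~` B).
Proof.
move=> [mB apB]; split; first exact: measurableC.
move=> e /apB[f [cf f01] fe].
exists (fun x => 1 - f x).
  split=> [x|x]; last by have := f01 x; lra.
  by apply: cvgB; [exact: cvg_cst|exact: cf].
rewrite (eq_integral (fun x : baireType R X => (`|f x - \1_B x|)%:E))// => x _.
rewrite !indicE in_setC; congr EFin; case: (x \in B) => /=.
  by rewrite subr0 distrC.
by rewrite subr0 addrAC subrr add0r normrN.
Qed.

(** The witness is [f + g - f * g = 1 - (1 - f) * (1 - g)], which for indicators is the indicator of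
    the union; its error is at most the sum of the two errors. *)
Lemma approximable_setU A B : approximable A -> approximable B ->
  approximable (A `|` B).
Proof.
move=> [mA apA] [mB apB]; split; first exact: measurableU.
move=> e e0; have e20 : 0 < e / 2 by rewrite divr_gt0.
have [f [cf f01] fe] := apA _ e20; have [g [cg g01] ge] := apB _ e20.
exists (fun x => f x + g x - f x * g x).
  split=> [x|x]; last by have := f01 x; have := g01 x; nra.
  by apply: cvgB; [apply: cvgD|apply: cvgM]; (exact: cf || exact: cg).
have mf := measurable_dist_indic cf mA; have mg := measurable_dist_indic cg mB.
apply: (@le_lt_trans _ _ (\int[m]_x ((`|f x - \1_A x|)%:E + (`|g x - \1_B x|)%:E))%E).
  apply: ge0_le_integral => //.
  - apply: measurable_dist_indic; last exact: measurableU.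
    by move=> x; apply: cvgB; [apply: cvgD|apply: cvgM]; (exact: cf || exact: cg).
  - exact: emeasurable_funD.
  - move=> x _; rewrite -EFinD lee_fin !indicE in_setU.
    have := f01 x; have := g01 x.
    case: (x \in A); case: (x \in B) => /= /andP[g0 g1] /andP[f0 f1];
      rewrite ?subr0 ?(ger0_norm f0) ?(ger0_norm g0) ?ler_norml
        ?(ler0_norm (_ : f x - 1 <= 0)) ?(ler0_norm (_ : g x - 1 <= 0)) ?subr_le0//; nra.
rewrite ge0_integralD//.
by rewrite (splitr e) EFinD lteD.
Qed.

(** The finite unions [U n] exhaust the union, so what they miss has measure below [e / 2] for some
    [n]; an approximation of [U n] within [e / 2] then works. *)
Lemma approximable_bigcup (F : nat -> set (baireType R X)) :
  (forall n, approximable (F n)) -> approximable (\bigcup_n F n).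
Proof.
move=> apF; pose U n := \big[setU/set0]_(i < n) F i.
have apU n : approximable (U n).
  rewrite /U; elim: n => [|n IH]; first by rewrite big_ord0; exact: approximable_set0.
  by rewrite big_ord_recr/=; exact: approximable_setU.
have mU n : measurable (U n) by have [] := apU n.
have mF : measurable (\bigcup_n F n).
  by apply: bigcupT_measurable => n; have [] := apF n.
split => // e e0; have e20 : 0 < e / 2 by rewrite divr_gt0.
have [|||n Vn] := @ex_small_measure _ _ _ m
  (fun n => (\bigcup_n F n) `\` U n) (e / 2) moo _ _ _ e20.
- by move=> n; exact: measurableD.
- move=> p q pq; apply/subsetPset; apply: setDS.
  exact: subset_bigsetU.
- apply/seteqP; split => // x /= H; have [[n _ Fnx] _] := H 0%N I.
  have [_ ] := H n.+1 I; apply; rewrite /U big_ord_recr/=; by right.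
have [_ /(_ _ e20)[f [cf f01] fe]] := apU n.
exists f => //.
pose V := (\bigcup_n F n) `\` U n.
have mV : measurable V by exact: measurableD.
apply: (@le_lt_trans _ _ (\int[m]_x ((`|f x - \1_(U n) x|)%:E + (\1_V x)%:E))%E).
  apply: ge0_le_integral => //.
  - exact: measurable_dist_indic.
  - apply: emeasurable_funD; first exact: measurable_dist_indic.
    by apply/measurable_EFinP.
  - move=> x _; rewrite -EFinD lee_fin.
    have -> : \1_(\bigcup_n F n) x = \1_(U n) x + \1_V x :> R.
      rewrite !indicE /V in_setD.
      have [xU|xU] := boolP (x \in U n); last by rewrite add0r andbT.
      rewrite andbF addr0 mem_set//; move/set_mem: xU.
      by rewrite /U -bigcup_mkord => -[i _ Fix]; exists i.
    rewrite opprD addrA; apply: le_trans (ler_normB _ _) _.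
    by rewrite lerD2l ger0_norm.
rewrite ge0_integralD//; last 2 first.
- exact: measurable_dist_indic.
- by apply/measurable_EFinP.
by rewrite (splitr e) EFinD lteD// integral_indic// setIT.
Qed.

(** The truncation of [n.+1 * (f - a)] to [0, 1] differs from the indicator only where
    [a < f < a + 1 / n.+1], and there by at most 1. These sets decrease to the empty set. *)
Lemma approximable_ray f (a : R) : continuous f ->
  approximable (f @^-1` `]a, +oo[).
Proof.
move=> cf; have mf := continuous_baire cf.
have mS (S : set R) : measurable S -> measurable (f @^-1` S : set (baireType R X)).
  by move=> mS; rewrite -[X in measurable X]setTI; exact: mf.
split; first exact: mS.
move=> e e0; pose F n : set (baireType R X) := f @^-1` `]a, a + n.+1%:R^-1[.
have [|||n Fn] := @ex_small_measure _ _ _ m F e moo _ _ _ e0.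
- by move=> n; exact: mS.
- move=> p q pq; apply/subsetPset => x; rewrite /F/= !in_itv/= => /andP[-> /=].
  move=> /lt_le_trans; apply; rewrite lerD2l lef_pV2 ?posrE//.
  by rewrite ler_nat ltnS.
- apply/seteqP; split => // x /= H.
  have afx : 0 < f x - a by have := H 0%N I; rewrite /F/= in_itv/= subr_gt0 => /andP[].
  have [n nfx] : exists n, n.+1%:R^-1 < f x - a.
    exists (Num.truncn (f x - a)^-1).
    by rewrite invf_plt ?posrE// truncnS_gt.
  have := H n I; rewrite /F/= in_itv/= => /andP[_].
  by rewrite ltNge => /negP; apply; rewrite addrC -lerBrDr ltW.
pose g : X -> R^o := cst 1 \min (cst 0 \max (fun x => n.+1%:R * (f x - a))).
have cg : continuous g.
  move=> x; apply: continuous_min; first exact: cvg_cst.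
  apply: continuous_max; first exact: cvg_cst.
  apply: cvgM; first exact: cvg_cst.
  by apply: cvgB; [exact: cf|exact: cvg_cst].
exists g; first split => // x.
  by rewrite /g/= le_min ler01 le_max lexx ge_min lexx.
have mE : measurable (f @^-1` `]a, +oo[ : set (baireType R X)) by exact: mS.
apply: le_lt_trans Fn; rewrite -(setIT (F n)) -integral_indic//; last exact: mS.
apply: ge0_le_integral => //.
- exact: measurable_dist_indic.
- by apply/measurable_EFinP; apply: measurable_indic; exact: mS.
move=> x _; rewrite lee_fin !indicE /g/=.
have n0 : 0 < n.+1%:R :> R by [].
have [ax|ax] := ltP a (f x); last first.
  rewrite memNset/=; last by rewrite in_itv/= andbT ltNge ax.
  rewrite (max_idPl _); last by rewrite pmulr_rle0// subr_le0.
  by rewrite (min_idPr _) ?ler01// subr0 normr0.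
rewrite (@mem_set _ (f @^-1` `]a, +oo[)); last by rewrite /= in_itv/= ax.
rewrite (max_idPr _); last by rewrite pmulr_rge0// subr_ge0 ltW.
have [xn|xn] := ltP (f x) (a + n.+1%:R^-1).
  rewrite (@mem_set _ (F n)); last by rewrite /F/= in_itv/= ax.
  rewrite distrC ger0_norm; last by rewrite subr_ge0 ge_min lexx.
  by rewrite gerBl le_min ler01 pmulr_rge0// subr_ge0 ltW.
rewrite (min_idPl _) ?subrr ?normr0//.
by rewrite -ler_pdivrMl// mulr1 lerBrDl.
Qed.

(** Two generation arguments are nested: the approximable sets form a sigma-algebra, and so do the
    sets of reals whose preimage under a given continuous [f] is approximable. The latter contains
    the open rays, hence all Borel sets. *)
Lemma baire_approximable B : measurable B -> approximable B.
Proof.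
move=> mB; suff : <<s @baire_generators R X >> `<=` approximable by apply.
apply: smallest_sub.
  split.
  - exact: approximable_set0.
  - by move=> A apA; rewrite setTD; exact: approximable_setC.
  - exact: approximable_bigcup.
move=> _ [f cf [S mS <-]]; rewrite setTI.
have : <<s @RGenOInfty.G R >> S.
  by move: (mS : (@ocitv R).-sigma.-measurable S); rewrite RGenOInfty.measurableE.
suff : <<s @RGenOInfty.G R >> `<=` [set S | approximable (f @^-1` S)] by apply.
apply: smallest_sub.
  split => /=.
  - by rewrite preimage_set0; exact: approximable_set0.
  - by move=> A apA; rewrite setTD preimage_setC; exact: approximable_setC.
  - by move=> F apF; rewrite preimage_bigcup; exact: approximable_bigcup.
by move=> _ [a ->]; exact: approximable_ray.
Qed.

End baire_regularity.

(** * Zero-sets and their countable intersections *)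

Section zero_sets.
Context {R : realType} {X : ptopologicalType}.

Lemma zero_set_ge (f : X -> R) (c : R) : continuous f ->
  zero_set R [set x | c <= f x].
Proof.
move=> cf; exists ((fun x => c - f x) \max cst 0 : X -> R^o).
  move=> x; apply: continuous_max; last exact: cvg_cst.
  by apply: cvgB; [exact: cvg_cst|exact: cf].
apply/seteqP; split => x /= => [cfx|/eqP].
  by apply/max_idPr; rewrite subr_le0.
by move=> /eqP/max_idPr; rewrite subr_le0.
Qed.

(* [sup_n (min |f_n| 2^-n)] is continuous because the [n]-th term is uniformly
   at most [2^-n]; it vanishes exactly where all the [f_n] do. *)
Lemma zero_set_bigcap (F : nat -> set X) :
  (forall n, zero_set R (F n)) -> zero_set R (\bigcap_n F n).
Proof.
move=> zF.
have /choice[f fP] : forall n, exists f : X -> R,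
    continuous f /\ F n = f @^-1` [set 0].
  by move=> n; have [f cf ->] := zF n; exists f.
pose g n : X -> R^o := (fun x => `|f n x|) \min cst (2^-1 ^+ n).
have cg n : continuous (g n).
  move=> x; apply: continuous_min; last exact: cvg_cst.
  by apply: cvg_norm; exact: (fP n).1.
have h0 n : 0 < 2^-1 ^+ n :> R by rewrite exprn_gt0// invr_gt0.
have g0 n x : 0 <= g n x by rewrite /g/= le_min normr_ge0 ltW.
have gh n x : g n x <= 2^-1 ^+ n by rewrite /g/= ge_min lexx orbT.
have h1 n : 2^-1 ^+ n <= 1 :> R by rewrite exprn_ile1// ?invr_ge0// invf_le1// ler1n.
pose u x := sup (range (g ^~ x)).
have hs x : has_sup (range (g ^~ x)).
  split; first by exists (g 0%N x), 0%N.
  by exists 1 => _ [n _ <-]; exact: le_trans (gh n x) (h1 n).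
have gu n x : g n x <= u x by apply: sup_upper_bound => //; exists n.
have uge x y e : (forall n, g n x <= g n y + e) -> u x <= u y + e.
  move=> H; apply: ge_sup; first by have [] := hs x.
  by move=> _ [n _ <-]; apply: le_trans (H n) _; rewrite lerD2r.
exists u.
  move=> x; apply/cvgrPdist_le => e e0.
  have [N hN] : exists N, 2^-1 ^+ N <= e.
    have /cvgr0_norm_le/(_ e e0)[N _ HN] : (2^-1 ^+ n : R) @[n --> \oo] --> 0.
      by apply: cvg_expr; rewrite ger0_norm ?invr_ge0// invf_lt1// ltr1n.
    exists N; have := HN N (leqnn N).
    by rewrite /= ger0_norm// ltW.
  (* Only finitely many indices need a common neighbourhood: from [N] on, all values of [g n] lie in
     [0, e]. *)
  have : \forall y \near x, forall i : 'I_N, `|g i x - g i y| <= e.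
    apply: filter_forall => i.
    by have /cvgrPdist_le := cg i x; apply.
  apply: filterS => y Hy.
  have {}Hy n : `|g n x - g n y| <= e.
    have [nN|Nn] := ltnP n N; first exact: (Hy (Ordinal nN)).
    have hn : 2^-1 ^+ n <= e.
      by apply: le_trans hN; apply: ler_wiXn2l => //; rewrite invf_le1// ler1n.
    have := gh n x; have := gh n y; have := g0 n x; have := g0 n y.
    by rewrite ler_norml; move: hn; lra.
  have xy : u x <= u y + e by apply: uge => n; have := Hy n; rewrite ler_norml; lra.
  have yx : u y <= u x + e by apply: uge => n; have := Hy n; rewrite ler_norml; lra.
  by rewrite ler_norml; lra.
apply/seteqP; split => x /=.
  move=> Fx; apply/eqP; rewrite eq_le; apply/andP; split.
    apply: ge_sup; first by have [] := hs x.
    move=> _ [n _ <-]; have := Fx n I; rewrite (fP n).2 /= /g/= => ->.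
    by rewrite normr0 ge_min lexx.
  exact: le_trans (g0 0%N x) (gu 0%N x).
move=> ux n _; rewrite (fP n).2/=; apply/eqP; rewrite -normr_le0.
have := gu n x; rewrite ux /g/= ge_min => /orP[//|].
by rewrite leNgt h0.
Qed.

End zero_sets.

(** * Separation of two singular measures *)

Lemma separating_function (R : realType) (X : ptopologicalType)
    (mu nu : smeasure R X) (e : R) :
  mutually_singular mu nu -> 0 < e ->
  exists f : X -> R, [/\ unit_continuous f, variation_integral mu f < e &
    variation_integral nu (fun x => 1 - f x) < e].
Proof.
move=> [A [B [AB muA nuB]]] e0.
have mB := nuB.1.
pose m := measure_add (charge_variation (hahnP mu)) (charge_variation (hahnP nu)).
have moo : (m setT < +oo)%E.
  by rewrite /m measure_addE; apply: lte_add_pinfty; exact: charge_variation_lty.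
have [_ /(_ _ e0)[f [cf f01] fe]] := baire_approximable moo mB.
exists f.
have mf := continuous_baire cf.
pose g : baireType R X -> R := fun x => `|f x - \1_B x|.
have mg : measurable_fun setT g.
  by apply: measurableT_comp => //; apply: measurable_funB.
have B01 (x : baireType R X) : 0 <= (\1_B x : R) <= 1.
  by rewrite indicE; case: (x \in B); rewrite ?lexx ?ler01.
have g1 x : `|g x| <= 1.
  by rewrite /g normr_id ler_norml; have := f01 x; have := B01 x; lra.
have mu1 (k : {charge set (baireType R X) -> \bar R}) (S : set (baireType R X)) :
    measurable S -> charge_variation (hahnP k) S = 0%E ->
    variation_integral k (\1_S) = 0.
  move=> mS kS; rewrite -[RHS]/(fine 0%E); congr fine.
  by rewrite integral_indic// setIT.
have ge : variation_integral mu g + variation_integral nu g < e.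
  move: fe; rewrite ge0_integral_measure_add//; last exact/measurable_EFinP.
  have I (k : {charge set (baireType R X) -> \bar R}) :
      (\int[charge_variation (hahnP k)]_x (g x)%:E)%E = (variation_integral k g)%:E.
    rewrite fineK// integrable_fin_num//.
    exact: bounded_measurable_integrable (charge_variation_lty k) mg g1.
  by rewrite !I -EFinD lte_fin.
have vg0 (k : smeasure R X) : 0 <= variation_integral k g.
  by apply: variation_integral_ge0 => x; exact: normr_ge0.
have f1 x : `|f x| <= 1 by rewrite ler_norml; have := f01 x; lra.
have ind1 (S : set (baireType R X)) x : `|\1_S x : R| <= 1.
  by rewrite indicE; case: (x \in S); rewrite ?normr1 ?normr0 ?ler01.
(* An inequality up to the indicator of a null set [S] is enough to compare integrals. *)
have key (k : {charge set (baireType R X) -> \bar R}) (S : set (baireType R X))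
    (p : baireType R X -> R) :
    measurable_fun setT p -> (forall x, `|p x| <= 1) -> measurable S ->
    charge_variation (hahnP k) S = 0%E ->
    (forall x, p x <= g x + \1_S x) -> variation_integral k p <= variation_integral k g.
  move=> mp p1 mS kS pg.
  have mI : measurable_fun setT (\1_S : baireType R X -> R) by exact: measurable_indic.
  have m2 : measurable_fun setT (fun x => 1 * g x + 1 * \1_S x).
    by apply: measurable_funD; apply: measurable_funM.
  have := variation_integral_lin k 1 1 mg mI g1 (ind1 S).
  rewrite (mu1 k _ mS kS) mulr0 addr0 mul1r => <-.
  apply: (variation_integral_le k mp m2 (c := 2)) => x.
  - by apply: le_trans (p1 x) _; rewrite ler1n.
  - rewrite !mul1r; apply: le_trans (ler_normD _ _) _.
    by have := g1 x; have := ind1 S x; lra.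
  - by rewrite !mul1r.
have Cind (x : baireType R X) : \1_(~` B) x = 1 - \1_B x :> R.
  by rewrite !indicE in_setC; case: (x \in B); rewrite ?subrr ?subr0.
split => //.
- have S0 : charge_variation (hahnP mu) B = 0%E.
    apply/eqP; rewrite eq_le measure_ge0 andbT -(sits_on_variation muA).
    apply: le_measure; [exact: mem_set|apply: mem_set; apply: measurableC; exact: muA.1|].
    by move=> x Bx Ax; rewrite -[False]/(set0 x) -AB.
  apply: (le_lt_trans (key mu B f mf f1 mB S0 _)) => [x|].
    by rewrite -lerBlDr /g ler_norm.
  by have := vg0 nu; move: ge; lra.
- have S0 := sits_on_variation nuB.
  have mCB : measurable (~` B) by exact: measurableC.
  apply: (le_lt_trans (key nu (~` B) _ _ _ mCB S0 _)) => [|x|x|].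
  + by apply: measurable_funB => //; exact: measurable_cst.
  + by rewrite ler_norml; have := f01 x; lra.
  + rewrite Cind /g distrC; have := ler_norm (\1_B x - f x); lra.
  + by have := vg0 mu; move: ge; lra.
Qed.

(** * Separation uniform over two compact convex sets of measures *)

Section simultaneous_separation.
Context {R : realType} {X : ptopologicalType}.
Implicit Types (M N : set (smeasure R X)) (mu nu : smeasure R X).

(** The weak-star topology, a supremum, refines the initial topology of integration of [f]. *)
Lemma charge_integral_weak_star_continuous (f : X -> R) : Cb f ->
  continuous (fun mu : weak_star R X => charge_integral (mu : smeasure R X) f : R).
Proof.
move=> Cf mu.
have /cvg_sup/(_ (exist _ f Cf)) : nbhs (mu : weak_star R X) --> (mu : weak_star R X).
  exact: cvg_id.
move=> H; apply: cvg_trans (@initial_continuous _ _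
  (fun mu : smeasure R X => charge_integral mu f : R) mu).
exact: cvg_app.
Qed.

Lemma Cb_bounded (f : X -> R) : continuous f -> (forall x, `|f x| <= 1) -> Cb f.
Proof.
move=> cf f1; split => //; exists 1; split => // y y1 x _.
exact: le_trans (f1 x) (ltW y1).
Qed.

Definition continuous_unit_ball : set (X -> R) :=
  [set h : X -> R | continuous h /\ forall x, -1 <= h x <= 1].

Lemma convex_lt (t a b e : R) : 0 <= t <= 1 -> a < e -> b < e ->
  t * a + (1 - t) * b < e.
Proof.
move=> t01 ae be; have [ab|ba] := leP a b.
  by apply: le_lt_trans be; nra.
by apply: le_lt_trans ae; nra.
Qed.

Section unit_functions.
Variables (h f g : X -> R) (t : R).
Hypotheses (ch : continuous h) (h1 : forall x, -1 <= h x <= 1).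
Hypotheses (Uf : unit_continuous f) (Ug : unit_continuous g).
Hypothesis t01 : 0 <= t <= 1.

Lemma unit_continuous_convex : unit_continuous (fun x => t * f x + (1 - t) * g x).
Proof.
move: Uf Ug => [cf f01] [cg g01]; split=> x.
  by apply: cvgD; apply: cvgM; (exact: cvg_cst || exact: cf || exact: cg).
by have := f01 x; have := g01 x; move: t01; nra.
Qed.

Lemma unit_norm (k : X -> R) : unit_continuous k -> forall x, `|k x| <= 1.
Proof. by move=> [_ k01] x; rewrite ler_norml; have := k01 x; lra. Qed.

Lemma unitM_norm (k : X -> R) : unit_continuous k -> forall x, `|h x * k x| <= 1.
Proof.
move=> Uk x; rewrite normrM mulr_ile1//; last exact: unit_norm.
by rewrite ler_norml h1.
Qed.

Lemma unitM_baire (k : X -> R) : unit_continuous k ->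
  measurable_fun [set: baireType R X] (fun x : baireType R X => h x * k x).
Proof.
by move=> [ck _]; apply: measurable_funM; exact: continuous_baire.
Qed.

Lemma unitC (k : X -> R) : unit_continuous k -> unit_continuous (fun x => 1 - k x).
Proof.
move=> [ck k01]; split=> x; last by have := k01 x; lra.
by apply: cvgB; [exact: cvg_cst|exact: ck].
Qed.

Lemma charge_integralM_convex mu :
  charge_integral mu (fun x => h x * (t * f x + (1 - t) * g x)) =
  t * charge_integral mu (fun x => h x * f x) +
  (1 - t) * charge_integral mu (fun x => h x * g x).
Proof.
rewrite -(charge_integral_lin mu _ _ (unitM_baire Uf) (unitM_baire Ug)
  (unitM_norm Uf) (unitM_norm Ug)).
by congr charge_integral; apply/funext => x; ring.
Qed.

Lemma variation_integral_convex mu :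
  variation_integral mu (fun x => t * f x + (1 - t) * g x) =
  t * variation_integral mu f + (1 - t) * variation_integral mu g.
Proof.
have mf := continuous_baire Uf.1; have mg := continuous_baire Ug.1.
exact: (variation_integral_lin mu _ _ mf mg (unit_norm Uf) (unit_norm Ug)).
Qed.

End unit_functions.

Lemma variation_integralC_convex nu f g t : unit_continuous f ->
  unit_continuous g -> 0 <= t <= 1 ->
  variation_integral nu (fun x => 1 - (t * f x + (1 - t) * g x)) =
  t * variation_integral nu (fun x => 1 - f x) +
  (1 - t) * variation_integral nu (fun x => 1 - g x).
Proof.
move=> Uf Ug t01.
rewrite -(variation_integral_convex t (unitC Uf) (unitC Ug)).
by congr variation_integral; apply/funext => x; ring.
Qed.

(** Separating functions are multiplied: [f * g] lies below both factors, and
    [1 - f * g <= (1 - f) + (1 - g)], which is why each factor is taken with [e / 2]. *)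
Lemma separating_function_seq (s : seq (smeasure R X)) nu (e : R) :
  (forall mu, mu \in s -> mutually_singular mu nu) -> 0 < e ->
  exists f : X -> R, [/\ unit_continuous f,
    forall mu, mu \in s -> variation_integral mu f < e &
    variation_integral nu (fun x => 1 - f x) < e].
Proof.
elim: s e => [|mu s IH] e sing e0.
  exists (fun=> 1); split => //.
    by split=> [x|x]; [exact: cvg_cst|rewrite lexx ler01].
  rewrite (_ : (fun=> _) = cst 0); last by apply/funext => x; rewrite subrr.
  by rewrite /variation_integral Rintegral_cst// mul0r.
have e20 : 0 < e / 2 by rewrite divr_gt0.
have e2e : e / 2 < e by rewrite ltr_pdivrMr// ltr_pMr// ltr1n.
have [|f [Uf fs fnu]] := IH _ _ e20.
  by move=> k ks; apply: sing; rewrite inE ks orbT.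
have [g [Ug gmu gnu]] := separating_function (sing mu (mem_head _ _)) e20.
have [cf f01] := Uf; have [cg g01] := Ug.
have Ufg : unit_continuous (fun x => f x * g x).
  split=> x; last by have := f01 x; have := g01 x; nra.
  by apply: cvgM; [exact: cf|exact: cg].
have mf := continuous_baire cf; have mg := continuous_baire cg.
have mfg := continuous_baire Ufg.1.
exists (fun x => f x * g x); split => // [k|].
- rewrite inE => /predU1P[->|ks].
    apply: le_lt_trans (lt_trans gmu e2e).
    apply: (variation_integral_le mu mfg mg (unit_norm Ufg) (unit_norm Ug)) => x.
    by have := f01 x; have := g01 x; nra.
  apply: le_lt_trans (lt_trans (fs k ks) e2e).
  apply: (variation_integral_le k mfg mf (unit_norm Ufg) (unit_norm Uf)) => x.
  by have := f01 x; have := g01 x; nra.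
- have mf' := continuous_baire (unitC Uf).1; have mg' := continuous_baire (unitC Ug).1.
  have lin := variation_integral_lin nu 1 1 mf' mg'
    (unit_norm (unitC Uf)) (unit_norm (unitC Ug)).
  have m2 : measurable_fun setT (fun x : baireType R X => 1 * (1 - f x) + 1 * (1 - g x)).
    by apply: measurable_funD; apply: measurable_funM.
  apply: (@le_lt_trans _ _
      (variation_integral nu (fun x => 1 * (1 - f x) + 1 * (1 - g x)))).
    apply: (variation_integral_le nu (continuous_baire (unitC Ufg).1) m2 (c := 2)) => x.
    + by apply: le_trans (unit_norm (unitC Ufg) x) _; rewrite ler1n.
    + by rewrite ler_norml; have := f01 x; have := g01 x; lra.
    + by have := f01 x; have := g01 x; nra.
  by rewrite lin; move: fnu gnu; lra.
Qed.

Variables M N : set (smeasure R X).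
Hypotheses (Mcompact : weak_star_compact M) (Mconvex : convex_smeasures M).
Hypotheses (Ncompact : weak_star_compact N) (Nconvex : convex_smeasures N).
Hypothesis Nnonneg : N `<=` @nonneg_smeasure R X.
Hypothesis MN : forall mu nu, M mu -> N nu -> mutually_singular mu nu.

(* Minimax is applied to one test function at a time, keeping the constraints
   already obtained in the convex set of admissible [f].  To start it for a new
   test function and a given [mu], some admissible [f] must have small [|mu|(f)];
   this is why the induction carries the finite list [s] of measures. *)
Lemma separating_function_tests (l : seq (X -> R)) (s : seq (smeasure R X)) nu (e : R) :
  (forall h, h \in l -> continuous_unit_ball h) -> (forall mu, mu \in s -> M mu) ->
  N nu -> 0 < e ->
  exists f : X -> R, [/\ unit_continuous f,
    forall mu, mu \in s -> variation_integral mu f < e,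
    variation_integral nu (fun x => 1 - f x) < e &
    forall h mu, h \in l -> M mu -> charge_integral mu (fun x => h x * f x) < e].
Proof.
move=> + + Nnu e0; elim: l s => [|h l IH] s lh sM.
  have [|f [Uf fs fnu]] := @separating_function_seq s nu e _ e0.
    by move=> mu /sM Mmu; exact: MN.
  by exists f; split.
have {}IH s' := IH s' (fun k kl => lh k (mem_behead (s := h :: l) kl)).
have [ch h1] := lh h (mem_head _ _).
pose G : set (X -> R) := [set f | [/\ unit_continuous f,
    forall mu, mu \in s -> variation_integral mu f < e,
    variation_integral nu (fun x => 1 - f x) < e &
    forall h mu, h \in l -> M mu -> charge_integral mu (fun x => h x * f x) < e]].
have [|||||f [Uf fs fnu fl] fh] := @minimax R (weak_star R X) (X -> R) M G
    (fun mu f => charge_integral (mu : smeasure R X) (fun x => h x * f x)) e Mcompact.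
- move=> f [Uf _ _ _]; apply: charge_integral_weak_star_continuous.
  apply: Cb_bounded; last exact: unitM_norm.
  by move=> x; apply: cvgM; [exact: ch|exact: Uf.1].
- move=> mu mu' t Mmu Mmu' t01; have [rho Mrho rhoE] := Mconvex Mmu Mmu' t01.
  exists rho => // f [Uf _ _ _].
  exact: (charge_integral_convex (unitM_baire ch Uf) (unitM_norm h1 Uf) t01 rhoE).
- move=> f g t [Uf fs fnu fl] [Ug gs gnu gl] t01.
  exists (fun x => t * f x + (1 - t) * g x); last first.
    by move=> mu _; exact: charge_integralM_convex.
  split.
  + exact: unit_continuous_convex.
  + by move=> mu ms; rewrite variation_integral_convex// convex_lt// ?fs ?gs.
  + by rewrite variation_integralC_convex// convex_lt.
  + move=> k mu kl Mmu.
    have [ck k1] := lh k (mem_behead (s := h :: l) kl).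
    by rewrite charge_integralM_convex// convex_lt// ?fl ?gl.
- by have [f Gf] := IH s sM; exists f.
(* Adding [mu] to the list makes [|mu|(f)] small, and [mu(h f)] is at most [|mu|(f)]. *)
- move=> mu Mmu; have [|f [Uf fs fnu fl]] := IH (mu :: s).
    by move=> k; rewrite inE => /predU1P[->//|/sM].
  exists f.
    by split => // k ks; apply: fs; rewrite inE ks orbT.
  apply: le_lt_trans (fs mu (mem_head _ _)).
  apply: charge_integralM_le => //;
    [exact: continuous_baire|exact: continuous_baire Uf.1| |exact: Uf.2].
  by move=> x; rewrite ler_norml.
exists f; split => // k mu; rewrite inE => /predU1P[->|kl] Mmu; first exact: fh.
exact: fl.
Qed.

(** A second minimax, now over [N]: the constraints on [M] are kept in the convex set [G], and
    [separating_function_tests] treats each single [nu]. On [N] the variation integral is the charge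
    integral, hence affine and weak-star continuous in [nu]. *)
Lemma uniform_separating_function (l : seq (X -> R)) (e : R) :
  (forall h, h \in l -> continuous_unit_ball h) -> 0 < e ->
  exists f : X -> R, [/\ unit_continuous f,
    forall h mu, h \in l -> M mu -> charge_integral mu (fun x => h x * f x) < e &
    forall nu, N nu -> variation_integral nu (fun x => 1 - f x) < e].
Proof.
move=> lh e0.
pose G : set (X -> R) := [set f | unit_continuous f /\
    forall h mu, h \in l -> M mu -> charge_integral mu (fun x => h x * f x) < e].
have NV nu f : N nu -> unit_continuous f ->
    charge_integral nu (fun x => 1 - f x) = variation_integral nu (fun x => 1 - f x).
  move=> Nnu Uf; have UCf := unitC Uf.
  exact: (nonneg_charge_integral (Nnonneg Nnu) (continuous_baire UCf.1) (unit_norm UCf)).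
have [|||||f [Uf fl] fN] := @minimax R (weak_star R X) (X -> R) N G
    (fun nu f => charge_integral (nu : smeasure R X) (fun x => 1 - f x)) e Ncompact.
- move=> f [/unitC UCf _]; apply: charge_integral_weak_star_continuous.
  by apply: Cb_bounded; [exact: UCf.1|exact: unit_norm].
- move=> nu nu' t Nnu Nnu' t01; have [rho Nrho rhoE] := Nconvex Nnu Nnu' t01.
  exists rho => // f [/unitC UCf _].
  exact: (charge_integral_convex (continuous_baire UCf.1) (unit_norm UCf) t01 rhoE).
- move=> f g t [Uf fl] [Ug gl] t01.
  exists (fun x => t * f x + (1 - t) * g x); last first.
    move=> nu Nnu; rewrite !NV//; last exact: unit_continuous_convex.
    by rewrite variation_integralC_convex.
  split; first exact: unit_continuous_convex.
  move=> k mu kl Mmu; have [ck k1] := lh k kl.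
  by rewrite charge_integralM_convex// convex_lt// ?fl ?gl.
- have U0 : unit_continuous (fun _ : X => 0 : R).
    by split=> [x|x]; [exact: cvg_cst|rewrite lexx ler01].
  exists (fun=> 0); split => // k mu kl Mmu; have [ck k1] := lh k kl.
  (* Linearity with both coefficients zero shows that the zero function has integral 0, so it
     belongs to [G]. *)
  have := charge_integral_lin mu 0 0 (unitM_baire ck U0) (unitM_baire ck U0)
    (unitM_norm k1 U0) (unitM_norm k1 U0).
  rewrite !mul0r addr0; under [X in charge_integral _ X]eq_fun do rewrite !mul0r addr0.
  by under [X in _ -> charge_integral _ X < _]eq_fun do rewrite mulr0; move=> ->.
- move=> nu Nnu.
  have [//|f [Uf _ fnu fl]] := @separating_function_tests l [::] nu e lh _ Nnu e0.
  by exists f => //; rewrite NV.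
exists f; split => // nu Nnu; rewrite -NV//; exact: fN.
Qed.

End simultaneous_separation.

(** * Null sets and Markov's inequality *)

Section null_sets.
Context d (T : measurableType d) (R : realType).
Variable m : {measure set T -> \bar R}.

Lemma bigcup_null (F : nat -> set T) : (forall n, measurable (F n)) ->
  (forall n, m (F n) = 0%E) -> m (\bigcup_n F n) = 0%E.
Proof.
move=> mF F0; apply/eqP; rewrite eq_le measure_ge0 andbT.
have mU : measurable (\bigcup_n F n) by exact: bigcupT_measurable.
apply: le_trans (measure_sigma_subadditive m mF mU (@subset_refl _ _)) _.
by rewrite eseries0.
Qed.

End null_sets.

(** Integrate [\1_A <= 2 * f] against the total variation. *)
Lemma variation_markov d (T : measurableType d) (R : realType)
    (mu : {charge set T -> \bar R}) (f : T -> R) (A : set T) (c : R) :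
  measurable A -> measurable_fun setT f -> (forall x, `|f x| <= c) ->
  (forall x, 0 <= f x) -> (forall x, A x -> 2^-1 <= f x) ->
  fine (charge_variation (hahnP mu) A) <= 2 * variation_integral mu f.
Proof.
move=> mA mf fc f0 Af.
have mI : measurable_fun setT (\1_A : T -> R) by exact: measurable_indic.
have m2 : measurable_fun setT (fun x => 2 * f x + 0 * f x).
  by apply: measurable_funD; apply: measurable_funM.
have -> : fine (charge_variation (hahnP mu) A) = variation_integral mu \1_A.
  by congr fine; rewrite integral_indic// setIT.
have := variation_integral_lin mu 2 0 mf mf fc fc; rewrite mul0r addr0 => <-.
have ind01 x : 0 <= (\1_A x : R) <= 1.
  by rewrite indicE; case: (x \in A); rewrite ?lexx ?ler01.
have c0 (x : T) : 0 <= c by exact: le_trans (fc x).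
apply: (variation_integral_le mu mI m2 (c := 1 + 2 * c)) => x.
- have := ind01 x; have := c0 x; rewrite ler_norml {c0}; lra.
- have := c0 x; have := fc x; rewrite !ler_norml mul0r addr0 {c0}; lra.
- rewrite mul0r addr0 indicE; have [xA|_] := boolP (x \in A).
    by have := Af x (set_mem xA); rewrite {c0}/=; lra.
  by rewrite mulr_ge0.
Qed.

(** * Construction of the separating set *)

Theorem theorem3 (R : realType) (X : ptopologicalType)
  (M N : set (smeasure R X))
  (Mcompact : weak_star_compact M) (Mconvex : convex_smeasures M)
  (Nnonneg : N `<=` @nonneg_smeasure R X)
  (Ncompact : weak_star_compact N) (Nconvex : convex_smeasures N)
  (MN : forall mu nu : smeasure R X, M mu -> N nu -> mutually_singular mu nu)
  (HM : exists H : set (X -> R),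
    [/\ countable H,
        (forall h, H h -> continuous h /\ (forall x, -1 <= h x <= 1)) &
        (forall mu : smeasure R X, M mu ->
          charge_total_variation mu [set: X] =
            ereal_sup [set (charge_integral mu h)%:E | h in H])]) :
  exists B : set X,
    [/\ Zsigma R B,
        (forall mu : smeasure R X, M mu -> sits_on mu (~` B)) &
        (forall nu : smeasure R X, N nu -> sits_on nu B)].
Proof.
have [H [/countable_injP[i iinj] Hcont Hnorm]] := HM.
(* Indices outside the image of [i] receive the zero function, which also lies in the unit ball; an
   empty [H] is thereby covered. *)
pose h n : X -> R := xget (cst 0) [set k | H k /\ i k = n].
have hH k : H k -> h (i k) = k.
  move=> Hk; rewrite /h; case: xgetP => [k' _ [Hk' ik']|/(_ k)]; last by case.
  by apply: iinj ik'; exact: mem_set.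
have hc n : continuous_unit_ball (h n).
  rewrite /h; case: xgetP => [k' -> [/Hcont//]|_].
  split; first by move=> x; exact: cvg_cst.
  by move=> x; rewrite /cst; lra.
(* Summability of [e] is what Borel-Cantelli requires; the powers are written as in
   [epsilon_trick0]. *)
pose e n : R := 1 / (2 ^ n.+1)%:R.
have e0 n : 0 < e n by rewrite divr_gt0// ltr0n expn_gt0.
have /choice[f fP] : forall n, exists f : X -> R, [/\ unit_continuous f,
    forall k mu, k \in [seq h j | j <- iota 0 n] -> M mu ->
      charge_integral mu (fun x => k x * f x) < e n &
    forall nu, N nu -> variation_integral nu (fun x => 1 - f x) < e n].
  move=> n.
  apply: (uniform_separating_function Mcompact Mconvex Ncompact Nconvex Nnonneg MN) => //.
  by move=> _ /mapP[j _ ->]; exact: hc.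
have Uf n : unit_continuous (f n) by have [] := fP n.
have mf n := continuous_baire (Uf n).1.
have mge (k : X -> R) c : continuous k ->
    measurable ([set x | c <= k x] : set (baireType R X)).
  move=> /continuous_baire mk; rewrite -[X in measurable X]setTI.
  rewrite (_ : [set x | c <= k x] = k @^-1` `[c, +oo[); first exact: mk.
  by apply/seteqP; split => x /=; rewrite in_itv/= andbT.
(* The shift [k + n] expresses all indices from [k] on as a plain countable intersection, to which
   [zero_set_bigcap] applies. *)
pose Z k : set (baireType R X) := \bigcap_n [set x | 2^-1 <= f (k + n)%N x].
have mZ k : measurable (Z k).
  by apply: bigcapT_measurable => n; apply: mge; exact: (Uf _).1.
have mB : measurable (\bigcup_k Z k) by exact: bigcupT_measurable.
exists (\bigcup_k Z k); split.
- exists Z => // k; apply: zero_set_bigcap => n.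
  by apply: zero_set_ge; exact: (Uf _).1.
- move=> mu Mmu; apply: variation_sits_on; first exact: measurableC.
  rewrite setCK; apply: bigcup_null => // k.
  transitivity (fine (charge_variation (hahnP mu) (Z k)))%:E.
    exact/esym/fineK/charge_variation_fin.
  congr EFin; apply/eqP; rewrite eq_le; apply/andP; split; last first.
    by rewrite fine_ge0.
  (* For suitable [g] in [H] and [n], Markov and [variation_integral_defect] bound [|mu|(Z k)] by
     twice the sum of [mu(g f_(k+n))] and [|mu|(X) - mu(g)]. Each summand is kept below [d / 4]. *)
  apply/ler_addgt0Pl => d d0; rewrite addr0.
  have d4 : 0 < d / 4 by rewrite divr_gt0.
  have [g Hg gmu] : exists2 g, H g &
      variation_integral mu (fun=> 1) - charge_integral mu g < d / 4.
    have V1 : ereal_sup [set (charge_integral mu h)%:E | h in H] =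
        (variation_integral mu (fun=> 1))%:E.
      rewrite -Hnorm// variation_integral1 fineK//; exact: charge_variation_fin.
    have [|_ [g Hg <-]] := ub_ereal_sup_adherent d4
      (S := [set (charge_integral mu h)%:E | h in H]).
      by rewrite V1.
    by rewrite V1 -EFinB lte_fin => ?; exists g => //; lra.
  have [p pd] : exists p, e p <= d / 4.
    have /cvgr0_norm_le/(_ _ d4)[p _ pd] : (2^-1 ^+ n : R) @[n --> \oo] --> 0.
      by apply: cvg_expr; rewrite ger0_norm ?invr_ge0// invf_lt1// ltr1n.
    exists p; have := pd p.+1 (leqnSn p).
    by rewrite /e /= ger0_norm// exprVn natrX mul1r.
  (* [p <= n] makes [e n] small, and [i g < n] puts [g] among the functions tested by [f (k + n)],
     whose indices are strictly below [k + n]. *)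
  pose n := maxn p (i g).+1.
  have en : e n <= d / 4.
    apply: le_trans pd; rewrite /e ler_pM2l// lef_pV2 ?posrE ?ltr0n ?expn_gt0//.
    by rewrite ler_nat leq_exp2l// ltnS leq_maxl.
  have en' : e (k + n)%N <= e n.
    rewrite /e ler_pM2l// lef_pV2 ?posrE ?ltr0n ?expn_gt0//.
    by rewrite ler_nat leq_exp2l// ltnS leq_addl.
  have [gc g1] := Hcont _ Hg.
  have g1' x : `|g x| <= 1 by rewrite ler_norml.
  have def := variation_integral_defect mu (continuous_baire gc)
    (mf (k + n)%N) g1' (Uf _).2.
  have [_ /(_ g mu) fg _] := fP (k + n)%N.
  have {}fg : charge_integral mu (fun x => g x * f (k + n)%N x) < e (k + n)%N.
    apply: fg => //; apply/mapP; exists (i g); last by rewrite hH.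
    by rewrite mem_iota/= add0n (leq_trans (leq_maxr p _))// leq_addl.
  have mk := variation_markov mu (mZ k) (mf (k + n)%N) (unit_norm (Uf _))
    (fun x => (andP ((Uf (k + n)%N).2 x)).1) (fun x Zx => Zx n I).
  by move: mk def fg gmu en en'; lra.
- move=> nu Nnu; apply: variation_sits_on => //.
  pose F n : set (baireType R X) := ~` [set x | 2^-1 <= f n x].
  have mF n : measurable (F n) by apply: measurableC; apply: mge; exact: (Uf _).1.
  rewrite (_ : ~` _ = lim_sup_set F); last first.
    rewrite setC_bigcup /lim_sup_set; apply: eq_bigcapr => k _.
    rewrite /Z setC_bigcap; apply/seteqP; split => x /=.
      by move=> [n _ Fx]; exists (k + n)%N => //=; exact: leq_addr.
    by move=> [n /= kn Fx]; exists (n - k)%N => //; rewrite subnKC.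
  apply: lim_sup_set_cvg0 => //.
  (* On [F n] the function [1 - f n] exceeds 1/2, so Markov bounds the measure of [F n] by
     [2 * e n]; these bounds have sum at most 2. *)
  apply: (@le_lt_trans _ _ (\sum_(n <oo) (2 / (2 ^ n.+1)%:R)%:E)%E).
    apply: lee_nneseries => // n _.
    have UC := unitC (Uf n).
    apply: (@le_trans _ _ (fine (charge_variation (hahnP nu) (F n)))%:E).
      by rewrite fineK// charge_variation_fin.
    rewrite lee_fin; apply: le_trans (variation_markov nu (mF n)
      (continuous_baire UC.1) (unit_norm UC) (fun x => (andP (UC.2 x)).1) _) _.
      by move=> x /negP; rewrite -ltNge; lra.
    have [_ _ /(_ nu Nnu)] := fP n.
    by rewrite /e; lra.
  by apply: le_lt_trans (epsilon_trick0 _ _) _ => //; rewrite ltry.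
Qed.
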